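(* Let $\mathcal C$ be a class of finite metrics closed under metric inversion, fix $q>0$, and let $a,b\ge 2$ be integers. Suppose the $q$-negative-type inequality holds throughout $\mathcal C$ for both sign patterns \[ (a-1)+(b+1)\qquad\text{and}\qquad (a+1)+(b-1). \] Then it also holds throughout $\mathcal C$ for the sign pattern $a+b$.
   Context: For a metric $d$ on a finite set $X$ and $p\in X$, the metric inversion at $p$ is $d^{(p)}(p,p)=0$, $d^{(p)}(p,x)=d^{(p)}(x,p)=1/d(p,x)$ for $x\ne p$, and $d^{(p)}(x,y)=\frac{d(x,y)}{d(x,p)d(y,p)}$ for $x,y\ne p$. The class $\mathcal C$ is closed under metric inversion if for every metric $d\in\mathcal C$ on $X$ and every $p\in X$, $d^{(p)}$ is again (a metric) in $\mathcal C$. A real vector $c\in\mathbb R^X$ with $\sum_x c_x=0$ has sign pattern $a+b$ if it has exactly $a$ positive and exactly $b$ negative entries (zero entries are allowed and ignored). The $q$-negative-type inequality holds throughout $\mathcal C$ for the pattern $a+b$ if $\sum_{x,y\in X}c_xc_y\,d(x,y)^q\le0$ for every $d\in\mathcal C$ (on its underlying set $X$) and every zero-sum $c\in\mathbb R^X$ of sign pattern $a+b$. *)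

(* Defs.v *)
From HB Require Import structures.
From mathcomp Require Import all_boot all_order all_algebra.
From mathcomp Require Import all_classical all_reals all_analysis.

Set Implicit Arguments.
Unset Strict Implicit.
Unset Printing Implicit Defensive.

Import Order.TTheory GRing.Theory Num.Theory.

Local Open Scope ring_scope.

(* Metrics are bare functions rather than instances of [metricType R], since
   the same set X has to carry several of them and no topology is used.
   Nonnegativity follows from these axioms. *)
Definition is_metric (R : realType) (X : Type) (d : X -> X -> R) : Prop :=
  [/\ forall x y : X, d x y = 0 <-> x = y,
      forall x y : X, d x y = d y x &
      forall x y z : X, d x z <= d x y + d y z].

Definition metric_inversion (R : realType) (X : eqType) (d : X -> X -> R)
    (p x y : X) : R :=
  if x == p then (if y == p then 0 else (d p y)^-1)
  else if y == p then (d p x)^-1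
  else d x y / (d x p * d y p).

(* A class need not be closed under isometry or under passing to subspaces. *)
Definition metric_class (R : realType) : Type :=
  forall X : finType, (X -> X -> R) -> Prop.

Definition class_of_metrics (R : realType) (C : metric_class R) : Prop :=
  forall (X : finType) (d : X -> X -> R), C X d -> is_metric d.

Definition closed_under_inversion (R : realType) (C : metric_class R) : Prop :=
  forall (X : finType) (d : X -> X -> R) (p : X),
    C X d -> C X (metric_inversion d p).

Definition has_sign_pattern (R : realType) (X : finType) (c : X -> R)
    (a b : nat) : Prop :=
  #|[set x : X | 0 < c x]| = a /\ #|[set x : X | c x < 0]| = b.

(* [powR 0 q = 0] for [q != 0], so the diagonal terms vanish when [0 < q]. *)
Definition negative_type_holds (R : realType) (C : metric_class R) (q : R)
    (a b : nat) : Prop :=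
  forall (X : finType) (d : X -> X -> R) (c : X -> R),
    C X d -> \sum_(x : X) c x = 0 -> has_sign_pattern c a b ->
    \sum_(x : X) \sum_(y : X) c x * c y * powR (d x y) q <= 0.

(* Main.v *)
Require Import Defs.
From mathcomp Require Import all_boot all_order all_algebra.
From mathcomp Require Import all_classical all_reals all_analysis.
From mathcomp Require Import ring lra.

(** Inversion at [p] turns [Q(c) = \sum_(x, y) c_x c_y d(x, y)^q] into itself,
    provided [c] is replaced by the zero-sum vector with entries
    [c_x d(x, p)^q] off [p] and [- s_p] at [p], where
    [s_p = \sum_x c_x d(x, p)^q]. Signs off [p] are kept. Since
    [Q(c) = \sum_p c_p s_p], if [Q(c) > 0] then some [p] has [c_p s_p > 0], and
    the new entry at [p] has the sign opposite to [c_p]: the pattern [a + b]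
    becomes one of its two neighbours, for which [Q <= 0]. *)

Set Implicit Arguments.
Unset Strict Implicit.
Unset Printing Implicit Defensive.

Import Order.TTheory GRing.Theory Num.Theory.

Local Open Scope ring_scope.

Lemma is_metric_ge0 (R : realType) (X : Type) (d : X -> X -> R) :
  is_metric d -> forall x y, 0 <= d x y.
Proof.
move=> [d0 dC dT] x y.
have := dT x y x; rewrite (d0 x x).2 // (dC y x); lra.
Qed.

Lemma is_metric_gt0 (R : realType) (X : eqType) (d : X -> X -> R) :
  is_metric d -> forall x y, x != y -> 0 < d x y.
Proof.
move=> dm x y xy; rewrite lt_neqAle is_metric_ge0 // andbT eq_sym.
by apply: contra_neq xy; case: dm => d0 _ _; apply: (d0 x y).1.
Qed.

Lemma powRV (R : realType) (x q : R) : 0 <= x -> x^-1 `^ q = (x `^ q)^-1.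
Proof. by move=> x0; rewrite -powR_inv1 // -powRrM mulN1r powRN. Qed.

(** The real power is multiplicative on nonnegative reals, so it passes through each case of the
    inversion; [q != 0] keeps the entry at [(p, p)] zero. The form can thus be computed with [d ^ q]
    as the kernel. *)
Lemma powR_metric_inversion (R : realType) (X : eqType) (d : X -> X -> R)
    (q : R) (p x y : X) : (forall x y, 0 <= d x y) -> q != 0 ->
  metric_inversion d p x y `^ q
    = metric_inversion (fun x y => d x y `^ q) p x y.
Proof.
move=> d_ge0 q0.
rewrite /metric_inversion.
case: (eqVneq x p) => [_|xp]; case: (eqVneq y p) => [_|yp].
- by rewrite powR0.
- by rewrite powRV.
- by rewrite powRV.
- by rewrite powRM ?invr_ge0 ?mulr_ge0 // powRV ?mulr_ge0 // powRM.
Qed.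

(** Here [D] plays the role of [d ^ q], which may violate the triangle inequality. *)
Definition inversion_weight {R : realType} {X : finType} (D : X -> X -> R)
    (p : X) (c : X -> R) (x : X) : R :=
  if x == p then - \sum_y c y * D y p else c x * D x p.

Section InversionWeight.
Variables (R : realType) (X : finType) (D : X -> X -> R) (p : X) (c : X -> R).
Hypothesis Dpp : D p p = 0.

(** As [D p p = 0], the sum in the entry at [p] is the total of the entries off [p], with the sign
    that cancels it. *)
Lemma sum_inversion_weight : \sum_x inversion_weight D p c x = 0.
Proof.
rewrite (bigD1 p) //= /inversion_weight eqxx [X in - X](bigD1 p) //= Dpp mulr0.
rewrite add0r addrC; apply/eqP; rewrite subr_eq0; apply/eqP.
by apply: eq_bigr => x /negbTE ->.
Qed.

Hypothesis DC : forall x y, D x y = D y x.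
Hypothesis D_neq0 : forall x, x != p -> D x p != 0.
Hypothesis c_sum0 : \sum_x c x = 0.

(** Off [p] the weights cancel the denominators of the inversion, so that block is unchanged. Row
    [p] and column [p] contribute [s * c p] each, before and after: after inversion their terms are
    [- s * c y], and [c] sums to [- c p] off [p]. *)
Lemma inversion_weight_form :
  \sum_x \sum_y inversion_weight D p c x * inversion_weight D p c y
      * metric_inversion D p x y
    = \sum_x \sum_y c x * c y * D x y.
Proof.
set s := \sum_y c y * D y p.
have sumN : \sum_(x | x != p) c x = - c p.
  by move: c_sum0; rewrite (bigD1 p) //= addrC => /eqP; rewrite addr_eq0 => /eqP.
have sE : \sum_(x | x != p) c x * D x p = s.
  by rewrite /s [RHS](bigD1 p) //= Dpp mulr0 add0r.
rewrite (bigD1 p) //= [RHS](bigD1 p) //=.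
have -> : \sum_y inversion_weight D p c p * inversion_weight D p c y
    * metric_inversion D p p y = s * c p.
  rewrite (bigD1 p) //= /metric_inversion eqxx mulr0 add0r.
  rewrite (eq_bigr (fun y => - s * c y)) => [|y yp].
    by rewrite -mulr_sumr sumN mulrNN.
  rewrite /inversion_weight eqxx (negbTE yp) -/s (DC p y) !mulrA mulfK //.
  exact: D_neq0.
have -> : \sum_y c p * c y * D p y = s * c p.
  by rewrite /s mulr_suml; apply: eq_bigr => y _; rewrite (DC p y); ring.
congr (_ + _).
(* Each row off [p] is split into its entry in column [p] and the block common to both sides. *)
rewrite (eq_bigr (fun x => - s * c x
    + \sum_(y | y != p) c x * c y * D x y)); last first.
  move=> x xp; rewrite (bigD1 p) //= /inversion_weight /metric_inversion.
  rewrite eqxx (negbTE xp) -/s (DC p x).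
  have xp0 := D_neq0 xp; congr (_ + _); first by field.
  apply: eq_bigr => y yp; rewrite (negbTE yp).
  by have yp0 := D_neq0 yp; field; rewrite xp0 yp0.
rewrite [RHS](eq_bigr (fun x => c p * (c x * D x p)
    + \sum_(y | y != p) c x * c y * D x y)); last first.
  by move=> x xp; rewrite (bigD1 p) //=; congr (_ + _); ring.
rewrite !big_split /= -!mulr_sumr sumN sE; ring.
Qed.

End InversionWeight.

(** Meant for the sign conditions on the old and new vectors, in either order: only the point [p]
    changes side. *)
Lemma cards_pred_off1 (X : finType) (p : X) (P Q : pred X) :
  {in [pred x | x != p], P =1 Q} -> P p -> ~~ Q p ->
  #|[set x | P x]| = #|[set x | Q x]|.+1.
Proof.
move=> PQ Pp Qp; rewrite (cardsD1 p) inE Pp add1n; congr _.+1.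
apply: eq_card => x; rewrite !inE.
by case: eqVneq => [->|xp] /=; [rewrite (negbTE Qp)|apply: PQ].
Qed.

Theorem theorem8p2 (R : realType) (C : metric_class R)
    (C_metric : class_of_metrics C) (C_inv : closed_under_inversion C)
    (q : R) (q_gt0 : 0 < q) (a b : nat) (a_ge2 : (2 <= a)%N) (b_ge2 : (2 <= b)%N)
    (H1 : negative_type_holds C q (a - 1) (b + 1))
    (H2 : negative_type_holds C q (a + 1) (b - 1)) :
  negative_type_holds C q a b.
Proof.
move=> X d c Cd c0 [ca cb]; rewrite leNgt; apply/negP => Q_gt0.
have dm := C_metric _ _ Cd; have [d0 dC _] := dm.
have q0 : q != 0 by rewrite gt_eqF.
pose D x y := d x y `^ q.
have DC x y : D x y = D y x by rewrite /D dC.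
have D0 x : D x x = 0 by rewrite /D (d0 x x).2 // powR0.
have D_gt0 x y : x != y -> 0 < D x y.
  by move=> xy; rewrite /D powR_gt0 // is_metric_gt0.
have [p cs_gt0] : exists p, 0 < c p * \sum_y c y * D y p.
  apply/not_existsP => all_le; move: Q_gt0; apply/negP; rewrite -leNgt.
  apply: sumr_le0 => x _; rewrite leNgt; apply/negP => x_gt0; apply: (all_le x).
  rewrite mulr_sumr (eq_bigr (fun y => c x * c y * d x y `^ q)) // => y _.
  by rewrite mulrA DC.
pose w := inversion_weight D p c.
have wp : w p = - \sum_y c y * D y p by rewrite /w /inversion_weight eqxx.
have w_gt0 x : x != p -> (0 < w x) = (0 < c x).
  by move=> xp; rewrite /w /inversion_weight (negbTE xp) pmulr_lgt0 ?D_gt0.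
have w_lt0 x : x != p -> (w x < 0) = (c x < 0).
  by move=> xp; rewrite /w /inversion_weight (negbTE xp) pmulr_llt0 ?D_gt0.
have w0 : \sum_x w x = 0 by apply: sum_inversion_weight.
have Qw : 0 < \sum_x \sum_y w x * w y * metric_inversion d p x y `^ q.
  under eq_bigr do under eq_bigr do
    rewrite (powR_metric_inversion _ _ _ (is_metric_ge0 dm)) //.
  by rewrite inversion_weight_form // => x /D_gt0; exact: lt0r_neq0.
(* The inverted metric is in [C] and gives [w] a positive form, so only the counting of signs
   remains. *)
have wNle m n : negative_type_holds C q m n -> ~ has_sign_pattern w m n.
  by move=> H /(H _ _ _ (C_inv _ _ p Cd) w0); rewrite leNgt Qw.
have cp0 : c p != 0 by apply: contraTneq cs_gt0 => ->; rewrite mul0r ltxx.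
case: (ltgtP (c p) 0) => [cp|cp|/eqP]; last by rewrite (negbTE cp0).
(* Here [p] moves from the negative to the positive entries. *)
- have wp_gt0 : 0 < w p by rewrite wp oppr_gt0 -(nmulr_rgt0 _ cp).
  apply: (wNle _ _ H2); split.
  + by rewrite addn1 -ca; apply: cards_pred_off1 w_gt0 wp_gt0 _; rewrite -leNgt ltW.
  (* Since [p] is among the points counted by [b], [b] is rewritten as a successor and the truncated
     [b - 1] is exact. *)
  + rewrite -cb (@cards_pred_off1 _ p (fun x => c x < 0) (fun x => w x < 0)).
    * by rewrite subn1.
    * by move=> x xp; rewrite w_lt0.
    * exact: cp.
    * by rewrite -leNgt ltW.
(* Here [p] moves from the positive to the negative entries. *)
- have wp_lt0 : w p < 0 by rewrite wp oppr_lt0 -(pmulr_rgt0 _ cp).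
  apply: (wNle _ _ H1); split.
  + rewrite -ca (@cards_pred_off1 _ p (fun x => 0 < c x) (fun x => 0 < w x)).
    * by rewrite subn1.
    * by move=> x xp; rewrite w_gt0.
    * exact: cp.
    * by rewrite -leNgt ltW.
  + by rewrite addn1 -cb; apply: cards_pred_off1 w_lt0 wp_lt0 _; rewrite -leNgt ltW.
Qed.
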